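(* Let $p(z)=z^n+a_{n-1}z^{n-1}+\cdots+a_1z+a_0$ be a monic polynomial of degree $n$ with coefficients $a_0,\dots,a_{n-1}\in\mathbb{C}$, let $C(p)$ be its Frobenius companion matrix, and let $\lambda$ be a zero of $p(z)$. Then $$|\lambda|\le w(C(p))\le\left(\frac12\beta\sqrt{\alpha}+\frac14\alpha+\frac14\beta^2\right)^{\frac12},$$ where $$\alpha=\left[1+\sum_{r=0}^{n-1}\left(|a_r|^2+|b_r|^2\right)\right]^{\frac12},$$ $$\beta=\left[\frac12\left(1+\sum_{r=0}^{n-1}|a_r|^2+\sqrt{\left(1+\sum_{r=0}^{n-1}|a_r|^2\right)^2-4|a_0|^2}\right)\right]^{\frac12},$$ and $b_r=a_{n-1}a_r-a_{r-1}$ for each $r=0,1,\dots,n-1$, with $a_{-1}=0$.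
   Context: The Frobenius companion matrix of $p$ is the $n\times n$ matrix $$C(p)=\begin{pmatrix}-a_{n-1}&-a_{n-2}&\cdots&-a_1&-a_0\\1&0&\cdots&0&0\\0&1&\cdots&0&0\\\vdots&\vdots&&\vdots&\vdots\\0&0&\cdots&1&0\end{pmatrix},$$ regarded as an operator on $\mathbb{C}^n$ with the usual inner product. The numerical radius of an operator $T$ on $\mathbb{C}^n$ is $w(T)=\sup\{|\langle Tx,x\rangle| : x\in\mathbb{C}^n,\ \|x\|=1\}$. *)

(* Defs.v *)
From HB Require Import structures.
From mathcomp Require Import all_boot all_order all_algebra spectral.
From mathcomp Require Import complex.
From mathcomp Require Import classical_sets reals.

Set Implicit Arguments.
Unset Strict Implicit.
Unset Printing Implicit Defensive.

Import Order.TTheory GRing.Theory Num.Theory.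
Import ComplexField.

Local Open Scope ring_scope.

(* [Normc.normc z : R] is the modulus of [z : R[i]]; the generic norm of
   [R[i]] would be valued in [R[i]]. *)
Notation cmod := Normc.normc.

(* The library's [dotmx] is a form on row vectors, whereas operators act here
   on column vectors. *)
Definition cdot {R : realType} {n : nat} (x y : 'cV[R[i]]_n) : R[i] :=
  dotmx x^T y^T.

Definition cnorm {R : realType} {n : nat} (x : 'cV[R[i]]_n) : R[i] :=
  sqrtC (cdot x x).

Definition numerical_radius {R : realType} {n : nat} (T : 'M[R[i]]_n) : R :=
  sup [set cmod (cdot (T *m x) x) | x in [set x | cnorm x = 1]]%classic.

(* Not the library's [companionmx], which has the coefficients in the last row,
   in increasing order. *)
Definition frobenius_companion {R : realType} (n : nat) (p : {poly R[i]})
    : 'M[R[i]]_n :=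
  \matrix_(i < n, j < n)
    if i == 0%N :> nat then - p`_(n.-1 - j) else (i == j.+1 :> nat)%:R.

Definition coef_b {R : realType} (n : nat) (p : {poly R[i]}) (r : nat)
    : R[i] :=
  p`_n.-1 * p`_r - (if r is s.+1 then p`_s else 0).

Definition alpha {R : realType} (n : nat) (p : {poly R[i]}) : R :=
  Num.sqrt (1 + \sum_(r < n) (cmod p`_r ^+ 2 + cmod (coef_b n p r) ^+ 2)).

Definition beta {R : realType} (n : nat) (p : {poly R[i]}) : R :=
  let s := 1 + \sum_(r < n) cmod p`_r ^+ 2 in
  Num.sqrt (2^-1 * (s + Num.sqrt (s ^+ 2 - 4 * cmod p`_0 ^+ 2))).

(* Main.v *)
Require Import Defs.
From mathcomp Require Import all_boot all_order all_algebra.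
From mathcomp Require Import complex.
From mathcomp Require Import reals.
From mathcomp Require Import sesquilinear spectral lra ring.

(** Write N for a bound of the norm of an operator T, and S for a bound of the
    norm of T^2.  Since
<<
      beta sqrt(alpha) / 2 + alpha / 4 + beta^2 / 4
        = ((beta + sqrt(alpha)) / 2)^2,
>>
    the upper bound is the inequality w(T) <= (N + sqrt S) / 2 of Kittaneh,
    applied to the companion matrix C with N = beta and S = alpha.  The lower
    bound holds because every zero of p is an eigenvalue of C
    ([companion_eigenvector]), hence lies in the numerical range.

    Kittaneh's inequality ([numerical_range_le]) is obtained here without
    absolute values of operators.  Multiplying T by a scalar of modulus 1 turns
    the complex number <Tx, x> into its modulus, so it suffices to bound
    Re <Tx, x>, that is, half of <(T + T^* )x, x>.  By the spectral theorem this
    form is at most mu |x|^2 for some eigenvalue mu of T + T^*, with an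
    eigenvector v ([hermitian_eigen]).  Put y = Tv and z = T^*v.  Then
    y + z = mu v, and applying T and T^* to this equation gives
<<
      mu y = T^2 v + T z,        mu z = T^* y + (T^* )^2 v,
>>
    so that mu |y| <= S |v| + N |z| and mu |z| <= N |y| + S |v|.  Adding them
    and using mu |v| <= |y| + |z| yields mu (mu - N) <= 2 S when mu >= N, which
    forces mu <= N + sqrt S as soon as sqrt S <= N; when sqrt S > N the trivial
    bound mu <= 2 N is enough ([crossed_le]).

    For the norm of C, the first entry of Cx is a combination of the entries of
    x and the other ones are all entries of x but the last.  Separating the
    last entry bounds |Cx|^2 by a quadratic form in two variables, whose larger
    eigenvalue is beta^2: the square of beta is the larger root of
    b^2 - s b + |a_0|^2, where s = 1 + sum |a_r|^2 ([quadratic_form_le],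
    [opbound_companion]).  For the norm of C^2, the first two entries of C^2 x
    are, up to sign, the combinations of the entries of x with coefficients
    b_r and a_r, and the remaining ones are entries of x, so Cauchy-Schwarz
    gives alpha ([opbound_companion_sqr]). *)

Set Implicit Arguments.
Unset Strict Implicit.

Import Order.TTheory GRing.Theory Num.Theory.
Local Open Scope ring_scope.
Local Open Scope sesquilinear_scope.

(** * The modulus of a complex number *)

Section Modulus.
Context {R : realType}.
Implicit Types z w : R[i].

Lemma cmod_norm z : `|z| = (cmod z)%:C%C.
Proof. by []. Qed.

Lemma cmod_ge0 z : 0 <= cmod z.
Proof. by rewrite -lecR -cmod_norm normr_ge0. Qed.

Lemma cmodM z w : cmod (z * w) = cmod z * cmod w.
Proof. exact: ComplexField.Normc.normcM. Qed.

Lemma cmodD z w : cmod (z + w) <= cmod z + cmod w.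
Proof. exact: le_normcD. Qed.

Lemma cmod_conj z : cmod z^* = cmod z.
Proof. by apply: complexI; rewrite -!cmod_norm norm_conjC. Qed.

Lemma cmod_sqr z : z * z^* = (cmod z ^+ 2)%:C%C.
Proof. by rewrite -normCK cmod_norm rmorphXn. Qed.

Lemma Re_le_cmod z : complex.Re z <= cmod z.
Proof.
case: z => a b /=; apply: le_trans (ler_norm a) _.
by rewrite -sqrtr_sqr ler_wsqrtr // lerDl sqr_ge0.
Qed.

Lemma cmod_real (r : R) : 0 <= r -> cmod (r%:C)%C = r.
Proof. by move=> r_ge0; apply: complexI; rewrite -cmod_norm ger0_norm ?ler0c. Qed.

End Modulus.

(** * The Euclidean norm and the adjoint *)

Section Euclidean.
Context {R : realType}.

(** The real-valued form of [cnorm] (see [cnormE]); the order of R is total,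
    which the linear and quadratic estimates below rely on. *)
Definition hnorm {n} (x : 'cV[R[i]]_n) : R :=
  Num.sqrt (\sum_i cmod (x i 0) ^+ 2).

Lemma hnorm_ge0 n (x : 'cV[R[i]]_n) : 0 <= hnorm x.
Proof. exact: sqrtr_ge0. Qed.

Lemma hnorm_sqr n (x : 'cV[R[i]]_n) : hnorm x ^+ 2 = \sum_i cmod (x i 0) ^+ 2.
Proof. by rewrite sqr_sqrtr // sumr_ge0 // => i _; rewrite sqr_ge0. Qed.

Lemma cdotE n (x y : 'cV[R[i]]_n) : cdot x y = \sum_i x i 0 * (y i 0)^*.
Proof.
by rewrite /cdot dotmxE mxE; apply: eq_bigr => i _; rewrite !mxE.
Qed.

Lemma cdot_self n (x : 'cV[R[i]]_n) : cdot x x = (hnorm x ^+ 2)%:C%C.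
Proof.
rewrite cdotE hnorm_sqr rmorph_sum; apply: eq_bigr => i _.
exact: cmod_sqr.
Qed.

Lemma cnormE n (x : 'cV[R[i]]_n) : cnorm x = (hnorm x)%:C%C.
Proof.
by rewrite /cnorm cdot_self rmorphXn /= sqrCK // ler0c hnorm_ge0.
Qed.

Lemma hnorm_gt0 n (x : 'cV[R[i]]_n) : x != 0 -> 0 < hnorm x.
Proof.
move=> x_neq0; rewrite lt_neqAle hnorm_ge0 andbT eq_sym.
apply: contra x_neq0 => /eqP hx0; apply/eqP/matrixP => i j.
rewrite ord1 mxE; apply/ComplexField.Normc.eq0_normc/eqP.
rewrite -sqrf_eq0; apply/eqP.
have := hnorm_sqr x; rewrite hx0 expr0n /= => /esym/eqP.
by rewrite psumr_eq0 => [/allP/(_ i (mem_index_enum _))/eqP|k _]; rewrite ?sqr_ge0.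
Qed.

Lemma cdot_le n (x y : 'cV[R[i]]_n) : cmod (cdot x y) <= hnorm x * hnorm y.
Proof.
rewrite -(@ler_pXn2r _ 2) ?nnegrE ?cmod_ge0 ?mulr_ge0 ?hnorm_ge0 //.
have : `|cdot x y| ^+ 2 <= cdot x x * cdot y y.
  exact: (CauchySchwarz (@dotmx _ n) x^T y^T).1.
rewrite !cdot_self cmod_norm -rmorphXn -rmorphM.
by rewrite lecR exprMn.
Qed.

Lemma cauchy_schwarz_sum n (a : 'I_n -> R[i]) (x : 'cV[R[i]]_n) :
  cmod (\sum_i a i * x i 0) ^+ 2 <= (\sum_i cmod (a i) ^+ 2) * hnorm x ^+ 2.
Proof.
pose b : 'cV[R[i]]_n := \col_i (a i)^*.
have -> : \sum_i a i * x i 0 = cdot x b.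
  by rewrite cdotE; apply: eq_bigr => i _; rewrite mxE conjCK mulrC.
have -> : \sum_i cmod (a i) ^+ 2 = hnorm b ^+ 2.
  by rewrite hnorm_sqr; apply: eq_bigr => i _; rewrite mxE cmod_conj.
rewrite mulrC -exprMn ler_pXn2r ?nnegrE ?cmod_ge0 ?mulr_ge0 ?hnorm_ge0 //.
exact: cdot_le.
Qed.

Lemma cdotDl n (x y z : 'cV[R[i]]_n) : cdot (x + y) z = cdot x z + cdot y z.
Proof. by rewrite /cdot linearD linearDl. Qed.

Lemma cdotZl n c (x z : 'cV[R[i]]_n) : cdot (c *: x) z = c * cdot x z.
Proof. by rewrite /cdot linearZ linearZl_LR. Qed.

Lemma cdotC n (x y : 'cV[R[i]]_n) : cdot x y = (cdot y x)^*.
Proof.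
rewrite !cdotE rmorph_sum; apply: eq_bigr => i _.
by rewrite rmorphM /= conjCK mulrC.
Qed.

Lemma cdotDr n (x y z : 'cV[R[i]]_n) : cdot x (y + z) = cdot x y + cdot x z.
Proof. by rewrite /cdot linearD linearDr. Qed.

Lemma cdot_adj n (T : 'M[R[i]]_n) (x y : 'cV[R[i]]_n) :
  cdot (T *m x) y = cdot x (T^t* *m y).
Proof.
rewrite /cdot !dotmxE !trmxK trmx_mul map_mxM /= -map_mx_comp.
by rewrite (map_mx_id (@conjCK _)) mulmxA.
Qed.

Lemma hnormZ n c (x : 'cV[R[i]]_n) : hnorm (c *: x) = cmod c * hnorm x.
Proof.
apply/eqP; rewrite -(@eqrXn2 _ 2) ?mulr_ge0 ?hnorm_ge0 ?cmod_ge0 //.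
rewrite exprMn !hnorm_sqr big_distrr /=; apply/eqP/eq_bigr => i _.
by rewrite mxE cmodM exprMn.
Qed.

Lemma hnormD n (x y : 'cV[R[i]]_n) : hnorm (x + y) <= hnorm x + hnorm y.
Proof.
rewrite -(@ler_pXn2r _ 2) ?nnegrE ?addr_ge0 ?hnorm_ge0 //.
have := cdot_self (x + y).
rewrite cdotDl !cdotDr !cdot_self (cdotC y x).
have := le_trans (Re_le_cmod _) (cdot_le x y).
move: (cdot x y) => [a b] /= le_a [sqE _]; nra.
Qed.

End Euclidean.

(** * Operator bounds and the numerical range *)

(** The numbers s, h, a, b stand for sqrt S and for the norms of v, T v and
    T^* v, where v is an eigenvector of T + T^* for mu. *)
Lemma crossed_le (R : realFieldType) (N S s mu h a b : R) :
    0 <= s -> s ^+ 2 = S -> 0 < h -> a <= N * h -> b <= N * h ->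
    mu * h <= a + b -> mu * a <= S * h + N * b -> mu * b <= N * a + S * h ->
  mu <= N + s.
Proof.
move=> s_ge0 sS h_gt0 le_a le_b le_h le_mua le_mub.
have [s_le|N_lt] := lerP s N; last first.
  have : mu * h <= (N + s) * h by nra.
  by rewrite ler_pM2r.
rewrite leNgt; apply/negP => mu_gt.
have sum_le : (mu - N) * (a + b) <= 2 * S * h by lra.
have : (mu - N) * (mu * h) <= 2 * S * h.
  by apply: le_trans sum_le; rewrite ler_wpM2l //; lra.
rewrite mulrA ler_pM2r // -sS => {le_a le_b le_h le_mua le_mub sum_le}; nra.
Qed.

Section NumericalRange.
Context {R : realType}.

Definition opbound {n} (T : 'M[R[i]]_n) (N : R) :=
  forall x : 'cV_n, hnorm (T *m x) <= N * hnorm x.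

(** From |T^* x|^2 = <T T^* x, x> <= N |T^* x| |x|. *)
Lemma opbound_adj n (T : 'M[R[i]]_n) N : opbound T N -> opbound (T^t*) N.
Proof.
move=> TN x; set y := T^t* *m x.
have [->|hy] := eqVneq (hnorm y) 0.
  have := TN x; have := hnorm_ge0 (T *m x); lra.
have {}hy : 0 < hnorm y by rewrite lt_neqAle eq_sym hy hnorm_ge0.
rewrite -(ler_pM2l hy) -expr2.
have -> : hnorm y ^+ 2 = complex.Re (cdot (T *m y) x) by rewrite cdot_adj cdot_self.
apply: le_trans (Re_le_cmod _) _; apply: le_trans (cdot_le _ _) _.
have := ler_wpM2r (hnorm_ge0 x) (TN y); lra.
Qed.

Lemma opbound_scale n (T : 'M[R[i]]_n) N c :
  cmod c = 1 -> opbound T N -> opbound (c *: T) N.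
Proof. by move=> c1 TN x; rewrite -scalemxAl hnormZ c1 mul1r. Qed.

(** In an orthonormal basis of eigenvectors, <Mx, x> is an average of the
    eigenvalues of M, weighted by the squared moduli of the coordinates of x;
    mu is the largest eigenvalue. *)
Lemma hermitian_eigen n (M : 'M[R[i]]_n) (x : 'cV[R[i]]_n) :
  M^t* = M -> hnorm x = 1 ->
  exists2 mu : R, complex.Re (cdot (M *m x) x) <= mu
    & exists2 v : 'cV_n, v != 0 & M *m v = mu%:C%C *: v.
Proof.
move=> M_herm x1; have hM : M \is hermsymmx.
  by apply/is_hermitianmxP; rewrite expr0 scale1r M_herm.
have := orthomx_spectralP (hermitian_normalmx hM).
have := hermitian_spectral_diag_real hM.
have := spectral_unitarymx M.
move: (spectralmx M) (spectral_diag M) => P D P_un D_real.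
have P_unit := unitarymx_unit P_un.
rewrite (invmx_unitary P_un) => M_eq.
pose d i := complex.Re (D 0 i).
have dE i : D 0 i = (d i)%:C%C by rewrite /d RRe_real // (mxOverP D_real).
(* The coordinates of x in the eigenbasis. *)
pose w := P *m x.
have w1 : \sum_i cmod (w i 0) ^+ 2 = 1.
  rewrite -hnorm_sqr; apply: complexI; rewrite -cdot_self cdot_adj /w mulmxA.
  by rewrite -(invmx_unitary P_un) mulVmx // mul1mx cdot_self x1 expr1n.
have ReE : complex.Re (cdot (M *m x) x) = \sum_i d i * cmod (w i 0) ^+ 2.
  suff -> : cdot (M *m x) x = (\sum_i d i * cmod (w i 0) ^+ 2)%:C%C by [].
  rewrite {1}M_eq -!mulmxA cdot_adj trmxCK -/w cdotE rmorph_sum.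
  apply: eq_bigr => i _; rewrite rmorphM /= -cmod_sqr mul_diag_mx mxE dE.
  by rewrite mulrA.
(* The dimension is positive, because x is a unit vector. *)
have [i0 _] : exists i0 : 'I_n, true.
  case: (pickP 'I_n) => [i0 _|no]; first by exists i0.
  by move: w1; rewrite big_pred0 // => /esym/eqP; rewrite oner_eq0.
case: (@arg_maxP _ _ _ i0 xpredT d isT) => k _ k_max.
exists (d k).
  rewrite ReE -[leRHS]mulr1 -w1 big_distrr /=; apply: ler_sum => i _.
  by rewrite ler_wpM2r ?sqr_ge0 //; apply: k_max.
exists (P^t* *m delta_mx k 0).
  apply/eqP => /(congr1 (mulmx P)); rewrite mulmxA mulmx0 (unitarymxP P_un).
  by rewrite mul1mx => /matrixP/(_ k 0)/eqP; rewrite !mxE !eqxx oner_eq0.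
rewrite M_eq -!mulmxA [P *m _]mulmxA (unitarymxP P_un) mul1mx scalemxAr.
congr (_ *m _); apply/matrixP => i j.
rewrite mul_diag_mx !mxE; case: (eqVneq i k) => [->|_]; first by rewrite dE.
by rewrite !mulr0.
Qed.

(** Both T and T^* are applied to the eigenvalue equation Tv + T^* v = mu v, so
    that the norms of T v and T^* v bound each other. *)
Lemma eigenvalue_le n (T : 'M[R[i]]_n) (N S mu : R) (v : 'cV[R[i]]_n) :
  opbound T N -> opbound (T *m T) S -> v != 0 ->
  (T + T^t*) *m v = mu%:C%C *: v -> mu <= N + Num.sqrt S.
Proof.
move=> TN TS v_neq0; have v_gt0 := hnorm_gt0 v_neq0.
rewrite mulmxDl; set y := T *m v; set z := T^t* *m v => yz.
have TN' := opbound_adj TN.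
have TS' : opbound (T^t* *m T^t*) S.
  by move=> x; rewrite -map_mxM -trmx_mul; apply: opbound_adj.
have N_ge0 : 0 <= N.
  rewrite -(ler_pM2r v_gt0) mul0r; exact: le_trans (hnorm_ge0 _) (TN v).
have S_ge0 : 0 <= S.
  rewrite -(ler_pM2r v_gt0) mul0r; exact: le_trans (hnorm_ge0 _) (TS v).
have [mu_le0|mu_gt0] := lerP mu 0.
  by apply: le_trans mu_le0 _; rewrite addr_ge0 ?sqrtr_ge0.
have mu_scale (x : 'cV[R[i]]_n) : hnorm (mu%:C%C *: x) = mu * hnorm x.
  by rewrite hnormZ cmod_real ?ltW.
have le_v : mu * hnorm v <= hnorm y + hnorm z by rewrite -mu_scale -yz hnormD.
have le_y : mu * hnorm y <= S * hnorm v + N * hnorm z.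
  rewrite -mu_scale {1}/y scalemxAr -yz mulmxDr.
  apply: le_trans (hnormD _ _) (lerD _ (TN z)).
  by rewrite /y mulmxA TS.
have le_z : mu * hnorm z <= N * hnorm y + S * hnorm v.
  rewrite -mu_scale {1}/z scalemxAr -yz mulmxDr.
  apply: le_trans (hnormD _ _) (lerD (TN' y) _).
  by rewrite /z mulmxA TS'.
exact: crossed_le (sqrtr_ge0 S) (sqr_sqrtr S_ge0) v_gt0 (TN v) (TN' v) le_v
  le_y le_z.
Qed.

(** Re <Tx, x> is half the value at x of the Hermitian form of T + T^*. *)
Lemma Re_numerical_range_le n (T : 'M[R[i]]_n) (N S : R) (x : 'cV[R[i]]_n) :
  opbound T N -> opbound (T *m T) S -> hnorm x = 1 ->
  complex.Re (cdot (T *m x) x) <= (N + Num.sqrt S) / 2.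
Proof.
move=> TN TS x1.
have [|mu le_mu [v v_neq0 vE]] := @hermitian_eigen n (T + T^t*) x _ x1.
  by rewrite linearD map_mxD /= trmxCK addrC.
have := eigenvalue_le TN TS v_neq0 vE.
move: le_mu; rewrite mulmxDl cdotDl.
have -> : cdot (T^t* *m x) x = (cdot (T *m x) x)^*.
  by rewrite [LHS]cdotC cdot_adj.
case: (cdot (T *m x) x) => a b /=; lra.
Qed.

(** Kittaneh's inequality: a rotation of T makes <Tx, x> a nonnegative real, and
    changes neither the bound of T nor that of T^2. *)
Lemma numerical_range_le n (T : 'M[R[i]]_n) (N S : R) (x : 'cV[R[i]]_n) :
  opbound T N -> opbound (T *m T) S -> hnorm x = 1 ->
  cmod (cdot (T *m x) x) <= (N + Num.sqrt S) / 2.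
Proof.
move=> TN TS x1; set t := cdot _ _.
have [t0|t_neq0] := eqVneq t 0.
  have := Re_numerical_range_le TN TS x1.
  by rewrite -/t t0 ComplexField.Normc.normc0.
have nt : (cmod t)%:C%C != 0 :> R[i] by rewrite -cmod_norm normr_eq0.
have nt' : cmod t != 0 by apply: contraNneq nt => ->.
pose c := t^* / (cmod t)%:C%C.
have c1 : cmod c = 1.
  by rewrite cmodM cmod_conj ComplexField.Normc.normcV cmod_real ?cmod_ge0 // divff.
have cTN := opbound_scale c1 TN.
have cTS : opbound ((c *: T) *m (c *: T)) S.
  rewrite -scalemxAl -scalemxAr; exact: opbound_scale c1 (opbound_scale c1 TS).
have := Re_numerical_range_le cTN cTS x1.
rewrite -scalemxAl cdotZl -/t /c mulrAC [t^* * t]mulrC cmod_sqr -fmorphV -rmorphM.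
by rewrite /= expr2 mulfK.
Qed.

End NumericalRange.

(** * The norms of the companion matrix and of its square *)

Lemma ler_of_sqr (R : realFieldType) (a b : R) : 0 <= b -> a ^+ 2 <= b ^+ 2 -> a <= b.
Proof. by move=> *; nra. Qed.

(** With e = h^2 and u = sqrt B * h, the left side is a quadratic form in
    (t, h) whose characteristic polynomial has root b.  Hence
    k = b - c^2 and q = b - 1 - B satisfy k q = c^2 B, so that the matrix
    with rows (k, - c sqrt B) and (- c sqrt B, q) has determinant 0; the bound
    s <= 2 b, which says that b is the larger root, makes its trace
    nonnegative. *)
Lemma quadratic_form_le (R : realFieldType) (c u t e B s b : R) :
    0 <= e -> 0 <= B -> u ^+ 2 <= B * e -> s = 1 + B + c ^+ 2 ->
    b ^+ 2 - s * b + c ^+ 2 = 0 -> s <= 2 * b ->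
  (u + c * t) ^+ 2 + e <= b * (e + t ^+ 2).
Proof.
move=> e_ge0 B_ge0 u_le sE b_root s_le.
pose k := b - c ^+ 2; pose q := b - 1 - B.
have kq : k * q = c ^+ 2 * B.
  by apply/eqP; rewrite -subr_eq0 -b_root /k /q sE; apply/eqP; ring.
have kq_ge0 : 0 <= k * q by rewrite kq mulr_ge0 ?sqr_ge0.
have kDq : 0 <= k + q by rewrite /k /q; lra.
have [k_ge0 q_ge0] : 0 <= k /\ 0 <= q by split; nra.
have cross : 2 * (c * t * u) <= k * t ^+ 2 + q * e.
  have rhs_ge0 : 0 <= k * t ^+ 2 + q * e.
    by apply: addr_ge0; apply: mulr_ge0; rewrite ?sqr_ge0.
  apply: ler_of_sqr => //.
  have -> : (2 * (c * t * u)) ^+ 2 = 4 * (c * t) ^+ 2 * u ^+ 2 by ring.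
  apply: (@le_trans _ _ (4 * (c * t) ^+ 2 * (B * e))).
    by rewrite ler_wpM2l // mulr_ge0 ?sqr_ge0.
  have -> : 4 * (c * t) ^+ 2 * (B * e) = 4 * (k * q) * (t ^+ 2 * e).
    by rewrite kq; ring.
  rewrite -subr_ge0; have := sqr_ge0 (k * t ^+ 2 - q * e).
  by congr (0 <= _); ring.
move: cross u_le; rewrite /k /q; clear; lra.
Qed.

Lemma sum_rev (V : nmodType) (m : nat) (f : nat -> V) :
  \sum_(j < m.+1) f (m - j)%N = \sum_(r < m.+1) f r.
Proof.
rewrite [RHS](reindex_inj rev_ord_inj) /=.
by apply: eq_bigr => j _; rewrite subSS.
Qed.

Section Companion.
Context {R : realType}.
Variables (m : nat) (p : {poly R[i]}).
Let C : 'M[R[i]]_m.+1 := frobenius_companion m.+1 p.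
Let init (i : 'I_m) : 'I_m.+1 := widen_ord (leqnSn m) i.

Lemma companion_mul0 (x : 'cV_m.+1) :
  (C *m x) 0 0 = - \sum_(j < m.+1) p`_(m - j) * x j 0.
Proof.
by rewrite !mxE -sumrN; apply: eq_bigr => j _; rewrite !mxE /= mulNr.
Qed.

Lemma companion_mulS (x : 'cV_m.+1) (i : 'I_m) :
  (C *m x) (lift ord0 i) 0 = x (init i) 0.
Proof.
rewrite !mxE (bigD1 (init i)) //= !mxE /= /bump /= add1n eqxx mul1r.
rewrite big1 ?addr0 // => j; rewrite !mxE /= /bump /= add1n eqSS.
by rewrite -(inj_eq val_inj) /= eq_sym => /negPf ->; rewrite mul0r.
Qed.

Lemma hnorm_companion (x : 'cV_m.+1) :
  hnorm (C *m x) ^+ 2 = cmod ((C *m x) 0 0) ^+ 2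
    + \sum_(i < m) cmod (x (init i) 0) ^+ 2.
Proof.
rewrite hnorm_sqr big_ord_recl; congr (_ + _).
by apply: eq_bigr => i _; rewrite companion_mulS.
Qed.

(** The last entry of x, which carries the coefficient a_0 in the first entry
    of Cx, is the only one that is not copied into Cx. *)
Lemma opbound_companion : opbound C (beta m.+1 p).
Proof.
move=> x; rewrite -(@ler_pXn2r _ 2) ?nnegrE ?mulr_ge0 ?hnorm_ge0 ?sqrtr_ge0 //.
rewrite exprMn hnorm_companion companion_mul0 normcN.
pose s : R := 1 + \sum_(r < m.+1) cmod p`_r ^+ 2.
pose c := cmod p`_0.
pose B := \sum_(j < m) cmod p`_(m - j) ^+ 2.
pose e := \sum_(i < m) cmod (x (init i) 0) ^+ 2.
pose u := cmod (\sum_(j < m) p`_(m - j) * x (init j) 0).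
pose t := cmod (x ord_max 0).
have sE : s = 1 + B + c ^+ 2.
  rewrite /s -(sum_rev m (fun r => cmod p`_r ^+ 2)) big_ord_recr /= subnn.
  by rewrite addrA.
have B_ge0 : 0 <= B by apply: sumr_ge0 => j _; rewrite sqr_ge0.
have e_ge0 : 0 <= e by apply: sumr_ge0 => j _; rewrite sqr_ge0.
have u_le : u ^+ 2 <= B * e.
  pose y : 'cV[R[i]]_m := \col_j x (init j) 0.
  have := cauchy_schwarz_sum (fun j : 'I_m => p`_(m - j)) y.
  rewrite hnorm_sqr; under eq_bigr do rewrite mxE.
  by under [X in _ * X]eq_bigr do rewrite mxE.
(* s >= 1 + c^2 >= 2 c. *)
have disc_ge0 : 0 <= s ^+ 2 - 4 * c ^+ 2.
  have : 0 <= (s - 2 * c) * (s + 2 * c).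
    have := sqr_ge0 (c - 1); have := sqr_ge0 (c + 1).
    by move=> h1 h2; apply: mulr_ge0; rewrite sE; nra.
  lra.
have := sqr_sqrtr disc_ge0; have := sqrtr_ge0 (s ^+ 2 - 4 * c ^+ 2).
have s_ge0 : 0 <= s by rewrite sE !addr_ge0 ?sqr_ge0.
have -> : beta m.+1 p ^+ 2 = 2^-1 * (s + Num.sqrt (s ^+ 2 - 4 * c ^+ 2)).
  apply: sqr_sqrtr; apply: mulr_ge0; first by rewrite invr_ge0.
  by apply: addr_ge0; first exact: s_ge0; apply: sqrtr_ge0.
move: (Num.sqrt _) => d d_ge0 dE.
have -> : hnorm x ^+ 2 = e + t ^+ 2 by rewrite hnorm_sqr big_ord_recr.
apply: le_trans (quadratic_form_le t e_ge0 B_ge0 u_le sE _ _); last by lra.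
  rewrite lerD2r ler_pXn2r ?nnegrE ?cmod_ge0 ?addr_ge0 ?mulr_ge0 ?cmod_ge0 //.
  by rewrite big_ord_recr /= subnn -cmodM cmodD.
by lra.
Qed.

Lemma companion_mul_mul0 (x : 'cV_m.+1) :
  (C *m (C *m x)) 0 0 = \sum_(j < m.+1) coef_b m.+1 p (m - j) * x j 0.
Proof.
rewrite companion_mul0 big_ord_recl companion_mul0 subn0.
under [X in - (_ + X)]eq_bigr => i _ do rewrite companion_mulS.
rewrite /coef_b /=; under [RHS]eq_bigr do rewrite mulrBl.
rewrite sumrB opprD mulrN opprK; congr (_ - _).
  by rewrite big_distrr /=; apply: eq_bigr => j _; rewrite mulrA.
(* The term with coefficient b_0 has no a_{r-1}. *)
rewrite big_ord_recr /= subnn mul0r addr0; apply: eq_bigr => i _.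
by rewrite /bump /= add1n -(subnSK (ltn_ord i)).
Qed.

(** The entries of C(Cx) are its first entry, the first entry of Cx, and
    entries of x; in dimension 1 the second of these does not occur, and the
    estimate only adds a nonnegative term. *)
Lemma opbound_companion_sqr : opbound (C *m C) (alpha m.+1 p).
Proof.
move=> x; rewrite -mulmxA.
rewrite -(@ler_pXn2r _ 2) ?nnegrE ?mulr_ge0 ?hnorm_ge0 ?sqrtr_ge0 //.
rewrite exprMn [alpha _ _ ^+ 2]sqr_sqrtr; last first.
  apply: addr_ge0 => //; apply: sumr_ge0 => r _.
  by apply: addr_ge0; apply: sqr_ge0.
rewrite big_split /= -(sum_rev m (fun r => cmod p`_r ^+ 2)).
rewrite -(sum_rev m (fun r => cmod (coef_b m.+1 p r) ^+ 2)).
have le_b := cauchy_schwarz_sum (fun j : 'I_m.+1 => coef_b m.+1 p (m - j)) x.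
have le_a := cauchy_schwarz_sum (fun j : 'I_m.+1 => p`_(m - j)) x.
move: le_b le_a; rewrite -companion_mul_mul0 -[cmod (\sum_i p`__ * _)]normcN.
rewrite -companion_mul0 hnorm_companion => le_b le_a.
have le_init (y : 'cV[R[i]]_m.+1) :
    \sum_(i < m) cmod (y (init i) 0) ^+ 2 <= hnorm y ^+ 2.
  by rewrite hnorm_sqr big_ord_recr lerDl sqr_ge0.
have le_Cx := le_init (C *m x); have le_x := le_init x.
rewrite hnorm_companion in le_Cx.
rewrite !mulrDl mul1r; lra.
Qed.

(** The rows of C below the first shift the powers of lambda; the first row of
    the eigenvalue equation is p(lambda) = 0. *)
Lemma companion_eigenvector (lambda : R[i]) (x := \col_(i < m.+1) lambda ^+ (m - i)) :
    p \is monic -> size p = m.+2 -> root p lambda ->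
  x != 0 /\ C *m x = lambda *: x.
Proof.
move=> p_monic size_p root_p; split.
  apply/eqP => /matrixP/(_ ord_max 0)/eqP.
  by rewrite !mxE subnn expr0 oner_eq0.
apply/matrixP => i j; rewrite ord1 {j}.
case: (unliftP ord0 i) => [k ->|->].
  by rewrite companion_mulS !mxE /= /bump /= add1n -exprS subnSK.
rewrite companion_mul0 !mxE subn0 -exprS.
under eq_bigr do rewrite mxE.
rewrite (sum_rev m (fun r => p`_r * lambda ^+ r)).
have := rootP root_p; rewrite horner_coef size_p big_ord_recr /=.
have -> : p`_m.+1 = 1 by have := monicP p_monic; rewrite lead_coefE size_p.
by rewrite mul1r => /eqP; rewrite addrC addr_eq0 => /eqP ->.
Qed.

End Companion.

(** * The bounds for the zeros and for the numerical radius *)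

Theorem theorem3p18 (R : realType) (n : nat) (p : {poly R[i]}) (lambda : R[i])
    (p_monic : p \is monic) (deg_p : size p = n.+1)
    (p_lambda : root p lambda) :
  cmod lambda <= numerical_radius (frobenius_companion n p) /\
  numerical_radius (frobenius_companion n p) <=
    Num.sqrt (2^-1 * beta n p * Num.sqrt (alpha n p)
              + 4^-1 * alpha n p + 4^-1 * beta n p ^+ 2).
Proof.
case: n deg_p => [|m] deg_p.
  (* In degree 0, the polynomial is 1 and has no zero. *)
  have := rootP p_lambda; rewrite horner_coef deg_p big_ord_recl big_ord0.
  rewrite addr0 mulr1; have := monicP p_monic; rewrite lead_coefE deg_p => ->.
  by move/eqP; rewrite oner_eq0.
set T := frobenius_companion _ _; set bound := Num.sqrt _.
have boundE : bound = (beta m.+1 p + Num.sqrt (alpha m.+1 p)) / 2.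
  rewrite /bound -[RHS]ger0_norm ?mulr_ge0 ?addr_ge0 ?sqrtr_ge0 ?invr_ge0 //.
  rewrite -sqrtr_sqr; congr Num.sqrt.
  have /sqr_sqrtr : 0 <= alpha m.+1 p by exact: sqrtr_ge0.
  by move: (Num.sqrt (alpha _ _)) => r <-; field.
have range_le (x : 'cV[R[i]]_m.+1) : cnorm x = 1 -> cmod (cdot (T *m x) x) <= bound.
  rewrite cnormE boundE => -[x1].
  exact: numerical_range_le (opbound_companion p) (opbound_companion_sqr p) x1.
have [x_neq0 Tx] := companion_eigenvector p_monic deg_p p_lambda.
move: x_neq0 Tx; set x := \col_ _ _ => x_neq0 Tx.
have x_gt0 := hnorm_gt0 x_neq0.
pose y := ((hnorm x)^-1)%:C%C *: x.
have y1 : hnorm y = 1.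
  by rewrite hnormZ cmod_real ?invr_ge0 ?hnorm_ge0 // mulVf ?gt_eqF.
have cy1 : cnorm y = 1 by rewrite cnormE y1.
have in_range : cmod lambda = cmod (cdot (T *m y) y).
  rewrite -scalemxAr Tx scalerA mulrC -scalerA cdotZl cdot_self y1 expr1n.
  by rewrite mulr1.
split.
  apply: ub_le_sup; last by exists y.
  by exists bound => _ [z z1 <-]; apply: range_le.
apply: ge_sup; first by exists (cmod lambda), y.
by move=> _ [z z1 <-]; apply: range_le.
Qed.
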